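(* Every irreducible root system is connected by triples zero sum.
   Context: Root systems are those of complex semisimple Lie algebras (reduced, crystallographic). Connectedness by triples zero sum. Let $\Gamma$ be a nonempty set of linear functionals. Two elements $\alpha,\beta\in\Gamma$ with $\alpha\ne\pm\beta$ are connected by triples zero sum (tzs) in $\Gamma$ if there is a finite chain of triples $T^1,\dots,T^n$, each of the form $T^p=\{\gamma_i,\gamma_j,\gamma_k\}\subset\Gamma$ with $\gamma_i+\gamma_j+\gamma_k=0$, such that $\alpha$ or $-\alpha$ belongs to $T^1$, $\beta$ or $-\beta$ belongs to $T^n$, and $T^p\cap T^{p+1}\neq\emptyset$ for $1\le p\le n-1$. The set $\Gamma$ is connected by tzs if every pair $\alpha,\beta\in\Gamma$ with $\alpha\neq\pm\beta$ is connected by tzs in $\Gamma$. *)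

(* Defs.v *)
From HB Require Import structures.
From mathcomp Require Import all_boot all_order all_algebra.
From mathcomp Require Import finmap.
From mathcomp Require Import boolp classical_sets reals.

Set Implicit Arguments.
Unset Strict Implicit.
Unset Printing Implicit Defensive.

Import Order.TTheory GRing.Theory Num.Theory.

Local Open Scope classical_set_scope.
Local Open Scope ring_scope.

(* [Gamma] is a set in an arbitrary additive group; linear functionals on a
   fixed vector space form one. Functionals play no further role here: only
   sums and opposites are used. *)
Section TriplesZeroSum.
Variables (V : zmodType) (Gamma : set V).

Definition tzs (T : set V) : Prop :=
  exists a b c : V,
    [/\ Gamma a, Gamma b, Gamma c, a + b + c = 0 & T = [set a; b; c]].

(* The chain is T 1, ..., T n; the values of T outside 1..n are irrelevant. *)
Definition connected_by_tzs (a b : V) : Prop :=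
  exists (n : nat) (T : nat -> set V),
    [/\ (1 <= n)%N,
        forall p : nat, (1 <= p <= n)%N -> tzs (T p),
        T 1%N a \/ T 1%N (- a),
        T n b \/ T n (- b)
      & forall p : nat, (1 <= p < n)%N -> T p `&` T p.+1 !=set0].

Definition tzs_connected : Prop :=
  Gamma !=set0 /\
  forall a b : V, Gamma a -> Gamma b -> a <> b -> a <> - b ->
    connected_by_tzs a b.

End TriplesZeroSum.

(* Reduced crystallographic root systems in the Euclidean space (V, dot);
   [{dot V for idfun}] is the type of positive definite symmetric bilinear
   forms on V. *)
Section RootSystems.
Variables (R : realType) (V : vectType R) (dot : {dot V for idfun}).

Definition cartan_number (b a : V) : R := 2 * dot b a / dot a a.

Definition root_reflection (a b : V) : V := b - cartan_number b a *: a.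

Record root_system (Phi : {fset V}) : Prop := RootSystem {
  root_span : <<Phi>>%VS = fullv;
  root_neq0 : 0 \notin Phi;
  root_reflect : forall a b : V, a \in Phi -> b \in Phi ->
    root_reflection a b \in Phi;
  root_crystallographic : forall a b : V, a \in Phi -> b \in Phi ->
    cartan_number b a \is a Num.int;
  root_reduced : forall (a : V) (c : R), a \in Phi -> c *: a \in Phi ->
    c = 1 \/ c = -1 }.

(* No partition into two nonempty mutually orthogonal parts; the empty root
   system (of the zero space) is not irreducible. *)
Definition irreducible_root_system (Phi : {fset V}) : Prop :=
  [/\ root_system Phi,
      Phi <> fset0
    & forall A B : {fset V}, (A `|` B)%fset = Phi -> [disjoint A & B]%fset ->
        (forall a b : V, a \in A -> b \in B -> dot a b = 0) ->
        A = fset0 \/ B = fset0].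

End RootSystems.

(* Main.v *)
Require Import Defs.
From mathcomp Require Import all_boot all_order all_algebra.
From mathcomp Require Import finmap.
From mathcomp Require Import boolp classical_sets reals.
From mathcomp Require Import zify ring lra.

Set Implicit Arguments.
Unset Strict Implicit.
Unset Printing Implicit Defensive.

Import Order.TTheory GRing.Theory Num.Theory.

Local Open Scope classical_set_scope.
Local Open Scope ring_scope.

(** If two non-proportional roots [a], [b] are not orthogonal, then [a - b] or
    [a + b] is a root, because the product of the two Cartan numbers is less
    than 4; so a single triple contains [a] and [b] up to sign. Since the
    opposite of a triple is a triple, signs can be adjusted when triples are
    concatenated. Hence the roots that are [a], [- a] or connected to [a] are
    orthogonal to the other roots, and irreducibility leaves no other root. *)

Section Chains.
Variables (V : zmodType) (Gamma : set V).

Lemma connected_by_tzsNr (a b : V) :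
  connected_by_tzs Gamma a b -> connected_by_tzs Gamma a (- b).
Proof.
move=> [n [T [n_gt0 tzsT Ta Tb meetT]]]; exists n, T; split=> //.
by rewrite opprK; case: Tb; [right|left].
Qed.

Lemma connected_by_triple (a b c : V) :
  Gamma a -> Gamma b -> Gamma c -> a + b + c = 0 -> connected_by_tzs Gamma a b.
Proof.
move=> Ga Gb Gc abc0; exists 1%N, (fun=> [set a; b; c]); split=> //.
- by move=> p _; exists a, b, c.
- by left; left; left.
- by left; left; right.
- by move=> [|p].
Qed.

(** The chain is passed unpacked because [connected_by_tzs] only gives its endpoint up to sign,
    whereas gluing [T'] needs an element [b] lying in both [T n] and [T']. *)
Lemma connected_by_tzs_rcons (T' : set V) (a b c : V) (n : nat)
    (T : nat -> set V) :
    (1 <= n)%N -> (forall p : nat, (1 <= p <= n)%N -> tzs Gamma (T p)) ->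
    T 1%N a \/ T 1%N (- a) ->
    (forall p : nat, (1 <= p < n)%N -> T p `&` T p.+1 !=set0) ->
    tzs Gamma T' -> T n b -> T' b -> T' c ->
  connected_by_tzs Gamma a c.
Proof.
move=> n_gt0 tzsT Ta meetT tzsT' Tb T'b T'c.
exists n.+1, (fun p => if (p <= n)%N then T p else T'); split=> //.
- move=> p /andP[p_gt0 _]; case: leqP => // p_le; apply: tzsT.
  by rewrite p_gt0.
- by rewrite n_gt0.
- by rewrite ltnn; left.
- move=> p /andP[p_gt0]; rewrite ltnS => p_le; rewrite p_le.
  case: ltnP => [p_lt|n_le]; first by apply: meetT; rewrite p_gt0.
  (* At the junction with [T'], the common element is [b]. *)
  have -> : p = n by apply/eqP; rewrite eqn_leq p_le.
  by exists b.
Qed.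

Hypothesis GammaN : forall x, Gamma x -> Gamma (- x).

Lemma connected_by_tzs_triple (x a b c : V) :
    connected_by_tzs Gamma x a ->
    Gamma a -> Gamma b -> Gamma c -> a + b + c = 0 ->
  connected_by_tzs Gamma x b.
Proof.
move=> [n [T [n_gt0 tzsT Tx Ta meetT]]] Ga Gb Gc abc0; case: Ta => Ta.
  apply: (connected_by_tzs_rcons n_gt0 tzsT Tx meetT _ Ta (T' := [set a; b; c])).
  - by exists a, b, c.
  - by left; left.
  - by left; right.
(* Here the chain ends in [- a]: the opposite triple extends it to [- b], which is as good as
   [b]. *)
rewrite -[b]opprK; apply: connected_by_tzsNr.
apply: (connected_by_tzs_rcons n_gt0 tzsT Tx meetT _ Ta
  (T' := [set - a; - b; - c])).
- exists (- a), (- b), (- c); split=> //; try exact: GammaN.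
  by rewrite -!opprD abc0 oppr0.
- by left; left.
- by left; right.
Qed.

End Chains.

(** Two integers that are both at least 2 have product at least 4. *)
Lemma int_mul_lt4 (R : archiNumDomainType) (x y : R) :
    x \is a Num.int -> y \is a Num.int -> 0 < x -> 0 < y -> x * y < 4 ->
  x = 1 \/ y = 1.
Proof.
move=> /intrP[m ->] /intrP[n ->]; rewrite !ltr0z -intrM.
rewrite -[4]/(4%:~R) ltr_int => m_gt0 n_gt0 mn_lt4.
have [->|->] : m = 1 \/ n = 1 by nia.
  by left.
by right.
Qed.

Section Roots.
Variables (R : realType) (V : vectType R) (dot : {dot V for idfun}).
Implicit Types (a b : V) (Phi : {fset V}).

Lemma dotC a b : dot a b = dot b a.
Proof. by rewrite hermC expr0 mul1r. Qed.

Lemma dotNl a b : dot (- a) b = - dot a b.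
Proof. exact: linearNl. Qed.

Lemma dotNr a b : dot a (- b) = - dot a b.
Proof. exact: linearNr. Qed.

Lemma cauchy_schwarz_lt a b :
    a != 0 -> (forall c : R, b <> c *: a) ->
  dot a b ^+ 2 < dot a a * dot b b.
Proof.
move=> a_neq0 b_free; have aa_gt0 : 0 < dot a a by exact: neq0_dnorm_gt0.
(* [c *: a] is the orthogonal projection of [b] on the line of [a]; the gap in the inequality is
   [dot a a] times the squared norm of [b - c *: a]. *)
pose c := dot a b / dot a a.
have : 0 < dot (b - c *: a) (b - c *: a).
  by apply: neq0_dnorm_gt0; rewrite subr_eq0; apply/eqP/b_free.
rewrite linearBl !linearBr !linearZl_LR !linearZr_LR /= (dotC b a) /c => vv_gt0.
rewrite -subr_gt0.
have -> : dot a a * dot b b - dot a b ^+ 2 =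
    dot a a * (dot b b - dot a b / dot a a * dot a b -
      (dot a b / dot a a * dot a b -
       dot a b / dot a a * (dot a b / dot a a * dot a a))).
  by field; rewrite gt_eqF.
by rewrite mulr_gt0.
Qed.

Variable Phi : {fset V}.
Hypothesis rsPhi : root_system dot Phi.

Lemma root_dot_gt0 a : a \in Phi -> 0 < dot a a.
Proof.
move=> aPhi; apply: neq0_dnorm_gt0.
by apply: contraNneq (root_neq0 rsPhi) => <-.
Qed.

(** The reflection in [a] sends [a] to [- a], since the Cartan number of [a] with itself is 2. *)
Lemma rootN a : a \in Phi -> - a \in Phi.
Proof.
move=> aPhi; have := root_reflect rsPhi aPhi aPhi.
rewrite /root_reflection /cartan_number mulfK ?gt_eqF ?root_dot_gt0 //.
by rewrite scaler_nat mulr2n opprD addrA subrr add0r.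
Qed.

Lemma root_sub a b : a \in Phi -> b \in Phi -> a <> b -> a <> - b ->
  0 < dot a b -> a - b \in Phi.
Proof.
move=> aPhi bPhi a_neq a_neqN ab_gt0.
have aa_gt0 := root_dot_gt0 aPhi; have bb_gt0 := root_dot_gt0 bPhi.
(* The inequality is strict: as [Phi] is reduced, a root proportional to [a] is [a] or [- a]. *)
have CS : dot a b ^+ 2 < dot a a * dot b b.
  apply: cauchy_schwarz_lt => [|c bE].
    by apply: contraTneq aPhi => ->; exact: root_neq0 rsPhi.
  have := bPhi; rewrite bE => /(root_reduced rsPhi aPhi)[c1|c1].
    by apply: a_neq; rewrite bE c1 scale1r.
  by apply: a_neqN; rewrite bE c1 scaleN1r opprK.
have cba_gt0 : 0 < cartan_number dot b a.
  by rewrite divr_gt0 // mulr_gt0 // dotC.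
have cab_gt0 : 0 < cartan_number dot a b by rewrite divr_gt0 // mulr_gt0.
have cc_lt4 : cartan_number dot b a * cartan_number dot a b < 4.
  rewrite /cartan_number (dotC b a) mulf_div ltr_pdivrMr ?mulr_gt0 //; nra.
(* One Cartan number is 1, so one of the two reflections is a plain subtraction, giving [b - a] or
   [a - b]. *)
have [c1|c1] := int_mul_lt4 (root_crystallographic rsPhi aPhi bPhi)
  (root_crystallographic rsPhi bPhi aPhi) cba_gt0 cab_gt0 cc_lt4.
- have := root_reflect rsPhi aPhi bPhi; rewrite /root_reflection c1 scale1r.
  by move/rootN; rewrite opprB.
- by have := root_reflect rsPhi bPhi aPhi; rewrite /root_reflection c1 scale1r.
Qed.

Lemma root_triple a b : a \in Phi -> b \in Phi -> a <> b -> a <> - b ->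
    dot a b <> 0 ->
  exists2 c, c \in Phi & a + b + c = 0 \/ a - b + c = 0.
Proof.
move=> aPhi bPhi a_neq a_neqN /eqP; rewrite neq_lt => /orP[ab_lt0|ab_gt0].
- exists (- (a - - b)); last by left; rewrite opprK subrr.
  by apply/rootN/root_sub; rewrite ?opprK ?rootN // dotNr oppr_gt0.
- exists (- (a - b)); last by right; rewrite subrr.
  exact/rootN/root_sub.
Qed.

Lemma connected_by_tzs_root_triple x a b :
    a \in Phi -> b \in Phi -> a <> b -> a <> - b -> dot a b <> 0 ->
    x = a \/ x = - a \/ connected_by_tzs [set` Phi] x a ->
  connected_by_tzs [set` Phi] x b.
Proof.
move=> aPhi bPhi a_neq a_neqN ab_neq0 xa.
(* Stated for any root [y], to be used with [b] and with [- b]. *)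
have triple y c : y \in Phi -> c \in Phi -> a + y + c = 0 ->
    connected_by_tzs [set` Phi] x y.
  move=> yPhi cPhi ayc0; case: xa => [->|[->|xa]].
  - exact: connected_by_triple ayc0.
  - rewrite -[y]opprK; apply: connected_by_tzsNr.
    apply: (@connected_by_triple _ _ _ _ (- c)) => /=; try exact: rootN.
    by rewrite -!opprD ayc0 oppr0.
  - by apply: connected_by_tzs_triple xa _ _ _ ayc0 => //; exact: rootN.
have [c cPhi [abc0|abc0]] := root_triple aPhi bPhi a_neq a_neqN ab_neq0.
  exact: triple abc0.
rewrite -[b]opprK; apply: connected_by_tzsNr.
by apply: triple abc0 => //; exact: rootN.
Qed.

End Roots.

Theorem lemma3p3 (R : realType) (V : vectType R) (dot : {dot V for idfun})
    (Phi : {fset V}) (hPhi : irreducible_root_system dot Phi) :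
  tzs_connected [set` Phi].
Proof.
have [rsPhi /eqP/fset0Pn[r rPhi] irr] := hPhi.
split=> [|x y /= xPhi yPhi x_neq x_neqN]; first by exists r.
(* The component of [x]; the roots [x] and [- x] are put in by hand, so that no chain from [x] to
   itself is required. *)
pose near z := [\/ z = x, z = - x | connected_by_tzs [set` Phi] x z].
have nearN z : near z -> near (- z).
  case=> [->|->|xz]; [exact: Or32|by rewrite opprK; exact: Or31|].
  exact/Or33/connected_by_tzsNr.
pose A := [fset z in Phi | `[< near z >]]%fset.
pose B := [fset z in Phi | ~~ `[< near z >]]%fset.
have : A = fset0 \/ B = fset0.
  apply: irr.
  - by apply/fsetP => z; rewrite !inE -andb_orr orbN andbT.
  - apply/fdisjointP => z; rewrite !inE => /andP[-> near_z].
    by rewrite near_z.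
  - move=> a b; rewrite !inE => /andP[aPhi /asboolP near_a].
    move=> /andP[bPhi /asboolP far_b]; apply: contrapT => ab_neq0.
    apply: far_b; have [->//|/eqP a_neq] := eqVneq b a.
    have [->|/eqP a_neqN] := eqVneq b (- a); first exact: nearN.
    apply/Or33/(connected_by_tzs_root_triple rsPhi aPhi bPhi _ _ ab_neq0).
    + by move=> ab; apply: a_neq.
    + by move=> ab; apply: a_neqN; rewrite ab opprK.
    + by case: near_a => [->|->|xa]; [left|right; left; rewrite opprK|right; right].
(* [A] contains [x], so [B] is empty and [y] is near [x]; as [y] is neither [x] nor [- x], a chain
   joins them. *)
case=> [/fsetP/(_ x)|/fsetP/(_ y)]; rewrite !inE ?xPhi ?yPhi /=.
  by move/asboolP; case; exact: Or31.
move/negbFE/asboolP; case=> // [yx|yx].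
  by case: x_neq.
by case: x_neqN; rewrite yx opprK.
Qed.
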